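(* Assume that $X$ is a convex, compact and non-empty subset of $\mathbb{R}^n=\prod_{\nu\in N}\mathbb{R}^{n_\nu}$. If for each $\nu\in N$ the objective function $\theta_\nu:\mathbb{R}^n\to\mathbb{R}$ is pseudo-continuous and quasi-convex with respect to its player's variable, then the set $\mathrm{RGNEP}(\{\theta_\nu,X\}_{\nu\in N})$ is non-empty.
   Context: $N$ is a finite non-empty set of players. For $x\in\mathbb{R}^n$, write $x=(x^\nu,x^{-\nu})$, where $x^\nu\in\mathbb{R}^{n_\nu}$ is the component of player $\nu$ and $x^{-\nu}$ collects the components of the other players. $\mathrm{RGNEP}(\{\theta_\nu,X\}_{\nu\in N})$ is the set of generalized Nash equilibria of Rosen's game: all $\hat x\in X$ such that for every $\nu\in N$ and every $x^\nu\in\mathbb{R}^{n_\nu}$ with $(x^\nu,\hat x^{-\nu})\in X$ one has $\theta_\nu(\hat x)\le\theta_\nu(x^\nu,\hat x^{-\nu})$. A function $f:\mathbb{R}^n\to\mathbb{R}$ is upper pseudo-continuous if for any $x,y\in\mathbb{R}^n$ with $f(x)<f(y)$ there is a neighbourhood $V_x$ of $x$ such that $f(x')<f(y)$ for all $x'\in V_x$; it is lower pseudo-continuous if $-f$ is upper pseudo-continuous; it is pseudo-continuous if it is both. A function $f$ is quasi-convex if $f(tx+(1-t)y)\le\max\{f(x),f(y)\}$ for all $x,y$ and $t\in[0,1]$; $\theta_\nu$ is quasi-convex with respect to its player's variable if $\theta_\nu(\cdot,x^{-\nu})$ is quasi-convex on $\mathbb{R}^{n_\nu}$ for every $x^{-\nu}$.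 *)

(* Defs.v *)
From HB Require Import structures.
From mathcomp Require Import all_boot all_order all_algebra.
From mathcomp Require Import all_classical all_reals all_analysis.

Set Implicit Arguments.
Unset Strict Implicit.
Unset Printing Implicit Defensive.

Import Order.TTheory GRing.Theory Num.Theory numFieldNormedType.Exports.
Local Open Scope classical_set_scope.
Local Open Scope ring_scope.

(* R^n = prod_(nu in N) R^(n_nu), with the product topology and the
   componentwise vector space structure.  The library has no lmodType structure
   on dependent products; one is needed for [convex_set]. *)
Definition profile (R : realType) (N : finType) (dim : N -> nat) : Type :=
  forall nu : N, 'rV[R]_(dim nu).

Section ProfileInstances.
Variables (R : realType) (N : finType) (dim : N -> nat).
Implicit Types x y z : profile R dim.

HB.instance Definition _ := Topological.copy (profile R dim)
  (prod_topology (fun nu : N => 'rV[R]_(dim nu))).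

Definition profile_zero : profile R dim := fun=> 0.
Definition profile_opp x : profile R dim := fun nu => - x nu.
Definition profile_add x y : profile R dim := fun nu => x nu + y nu.
Definition profile_scale (a : R) x : profile R dim := fun nu => a *: x nu.

Fact profile_addA : associative profile_add.
Proof. by move=> x y z; apply: functional_extensionality_dep => nu; exact: addrA. Qed.

Fact profile_addC : commutative profile_add.
Proof. by move=> x y; apply: functional_extensionality_dep => nu; exact: addrC. Qed.

Fact profile_add0 : left_id profile_zero profile_add.
Proof. by move=> x; apply: functional_extensionality_dep => nu; exact: add0r. Qed.

Fact profile_addN : left_inverse profile_zero profile_opp profile_add.
Proof. by move=> x; apply: functional_extensionality_dep => nu; exact: addNr. Qed.

HB.instance Definition _ := GRing.isZmodule.Build (profile R dim)
  profile_addA profile_addC profile_add0 profile_addN.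

Fact profile_scaleA a b x :
  profile_scale a (profile_scale b x) = profile_scale (a * b) x.
Proof. by apply: functional_extensionality_dep => nu; exact: scalerA. Qed.

Fact profile_scale1 : left_id 1 profile_scale.
Proof. by move=> x; apply: functional_extensionality_dep => nu; exact: scale1r. Qed.

Fact profile_scaleDr : right_distributive profile_scale +%R.
Proof. by move=> a x y; apply: functional_extensionality_dep => nu; exact: scalerDr. Qed.

Fact profile_scaleDl x : {morph profile_scale^~ x : a b / a + b}.
Proof. by move=> a b; apply: functional_extensionality_dep => nu; exact: scalerDl. Qed.

HB.instance Definition _ := GRing.Zmodule_isLmodule.Build R (profile R dim)
  profile_scaleA profile_scale1 profile_scaleDr profile_scaleDl.

End ProfileInstances.

(* (y, x^{-nu}): the profile [x] with player [nu]'s component replaced by [y] *)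
Definition deviate (R : realType) (N : finType) (dim : N -> nat)
    (x : profile R dim) (nu : N) (y : 'rV[R]_(dim nu)) : profile R dim :=
  dfwith x nu y.

Definition RGNEP (R : realType) (N : finType) (dim : N -> nat)
    (theta : N -> profile R dim -> R) (X : set (profile R dim)) :
    set (profile R dim) :=
  [set xhat | X xhat /\
    forall (nu : N) (y : 'rV[R]_(dim nu)),
      X (deviate xhat y) -> theta nu xhat <= theta nu (deviate xhat y)].

Definition upper_pseudo_continuous (R : realType) (T : topologicalType)
    (f : T -> R) : Prop :=
  forall x y : T, f x < f y -> \forall x' \near x, f x' < f y.

Definition lower_pseudo_continuous (R : realType) (T : topologicalType)
    (f : T -> R) : Prop :=
  upper_pseudo_continuous (fun x => - f x).

Definition pseudo_continuous (R : realType) (T : topologicalType)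
    (f : T -> R) : Prop :=
  upper_pseudo_continuous f /\ lower_pseudo_continuous f.

Definition quasi_convex (R : realType) (E : lmodType R) (f : E -> R) : Prop :=
  forall (x y : E) (t : R), 0 <= t -> t <= 1 ->
    f (t *: x + (1 - t) *: y) <= Num.max (f x) (f y).

Definition quasi_convex_own (R : realType) (N : finType) (dim : N -> nat)
    (nu : N) (f : profile R dim -> R) : Prop :=
  forall x : profile R dim,
    quasi_convex (fun y : 'rV[R]_(dim nu) => f (deviate x y)).

(* Main.v *)
From HB Require Import structures.
From mathcomp Require Import all_boot all_order all_algebra.
From mathcomp Require Import all_classical all_reals all_analysis.
From mathcomp Require Import finmap zify lra ring.
Require Import Defs.

(** Suppose that there is no equilibrium.  Then every profile of [X] has a
    player with a feasible improving deviation.  Pseudo-continuity says exactly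
    enough for strict preference to be an open relation
    ([pseudo_continuous_lt]), so that the deviation improves with a positive
    margin on a whole box around the profile ([improving_deviation_stable]).  By
    compactness finitely many such boxes, with centres [x_i], cover [X]; let
    [y_i] in [X] be the deviated profile attached to the box [i].

    A fixed point argument now produces a point of [X] that is an average of some
    of the [y_i] and belongs to all the corresponding boxes
    ([common_point_of_box_cover]).  It is a dual form of the lemma of Knaster,
    Kuratowski and Mazurkiewicz, equivalent to the fixed point theorem of
    Brouwer.  It is derived from a combinatorial lemma of Scarf
    ([scarf_colourful_dominant_set]), which does the work of the lemma of Sperner
    but needs only finitely many linear orders on a finite set instead of a
    triangulation, and no condition on the colours of the boundary.

    Such an average is absurd ([no_self_average]): each [y_i] used differs from
    it essentially in the component of one player, who strictly prefers [y_i].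
    The component of a well chosen player is then an average of strictly
    improving deviations, up to an error that their margins absorb, and
    quasi-convexity in the own variable makes it strictly better than itself.

    In this way nothing is asked of the best replies on the feasible slices of
    [X], which need not vary continuously, and the sum of the objectives, which
    need not be quasi-convex, does not appear. *)

Set Implicit Arguments.
Unset Strict Implicit.
Unset Printing Implicit Defensive.

(** * A combinatorial lemma of Scarf *)

Section Scarf.

(* Sets are finite sets in this section, not classical sets. *)
Import boot.fintype boot.finset.

(** A map missing injectivity by exactly one merges one pair of indices.  This
    is why a face of codimension one lies in two simplices: the map sending an
    order to its minimizer on the face merges two orders, and either of them can
    be handed over to a new vertex. *)
Lemma two_collapsing_indices (I V : finType) (f : I -> V) :
  #|f @: [set: I]|.+1 = #|I| ->
  exists i j, [/\ i != j, f i = f j,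
    {in ~: [set i] &, injective f} & {in ~: [set j] &, injective f}].
Proof.
move=> card_f.
have cardC1 (i : I) : #|~: [set i]| = #|f @: [set: I]|.
  by rewrite cardsC1 -card_f.
have inj_off (i j : I) : i != j -> f i = f j -> {in ~: [set i] &, injective f}.
  move=> ne_ij fij; apply/imset_injP; rewrite cardC1.
  suff -> : f @: [set: I] = f @: (~: [set i]) by [].
  apply/setP => v; apply/imsetP/imsetP => -[k _ ->]; last by exists k.
  have [->|ne_ki] := eqVneq k i; last by exists k; rewrite ?inE.
  by exists j; rewrite // !inE eq_sym.
have /injectivePn[i [j ne_ji fij]] : ~~ injectiveb f.
  apply/negP => /injectiveP inj_f.
  by move: card_f; rewrite card_imset // cardsT => /eqP; rewrite eqn_leq ltnn.
exists i, j; split=> //; first by exact: (inj_off i j).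
by apply: (inj_off j i); rewrite // eq_sym.
Qed.

(** Reading [r i] as the rank of a vertex in the [i]-th linear order, [S] is
    dominant when no vertex beats the minimum of [S] in all the orders at once.
    This order-theoretic notion plays the part of being the vertex set of a
    simplex in a triangulation. *)
Definition dominant (I V : finType) (r : I -> V -> nat) (S : {set V}) :=
  [forall y, exists i, forall x in S, r i y <= r i x].

Lemma dominantP (I V : finType) (r : I -> V -> nat) (S : {set V}) :
  reflect (forall y, exists i, forall x, x \in S -> r i y <= r i x)
          (dominant r S).
Proof.
apply: (iffP forallP) => dS y; have := dS y.
  by move=> /existsP[i /forall_inP]; exists i.
by move=> [i h]; apply/existsP; exists i; apply/forall_inP.
Qed.

Lemma dominantS (I V : finType) (r : I -> V -> nat) (A B : {set V}) :
  A \subset B -> dominant r B -> dominant r A.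
Proof.
move=> /subsetP sAB /dominantP dB; apply/dominantP => y.
by have [i h] := dB y; exists i => x /sAB; exact: h.
Qed.

Variables (I V : finType) (r : I -> V -> nat).
Hypothesis r_inj : forall i, injective (r i).

(** [e i] is the slack vertex of the coordinate [i], which stands for the facet
    on which that coordinate vanishes: it is least in the order [i] and above all
    proper vertices in the others.  With these vertices every simplex, on the
    boundary or not, has the same size [#|I|]. *)
Variable e : I -> V.
Hypothesis e_min : forall i v, r i (e i) <= r i v.
Hypothesis e_top : forall i j v, v \notin codom e -> j != i -> r i v <= r i (e j).
Variable v0 : V.
Hypothesis v0_proper : v0 \notin codom e.
Variable c : V -> I.
Hypothesis c_e : forall i, c (e i) = i.

(** The top-dimensional simplices.  The sets with one vertex less, which are
    candidates for being their faces of codimension one, are called doors. *)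
Definition rooms : {set {set V}} :=
  [set S : {set V} | dominant r S & #|S| == #|I|].

Lemma e_inj : injective e.
Proof. by move=> i j eij; rewrite -(c_e i) eij c_e. Qed.

Lemma rooms_aboveP (t : {set V}) (S : {set V}) : #|t|.+1 = #|I| ->
  reflect (exists2 x, x \notin t & S = x |: t /\ dominant r (x |: t))
          ((S \in rooms) && (t \subset S)).
Proof.
move=> card_t; apply: (iffP andP) => [[]|[x xt [-> dom]]]; last first.
  by rewrite inE dom subsetUr cardsU1 xt add1n card_t eqxx.
rewrite inE => /andP[dS /eqP cS] tS.
have /cards1P[x Sx] : #|S :\: t| == 1.
  by rewrite cardsD (setIidPr tS) cS -card_t subSnn.
have xSt : x \in S :\: t by rewrite Sx set11.
have defS : S = x |: t.
  by rewrite -(setID S t) (setIidPr tS) Sx setUC.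
by exists x; [move: xSt; rewrite inE => /andP[] | rewrite -defS].
Qed.


(** Every vertex of a dominant door [t] is the minimizer of some order, and there
    is one more order than vertices, so exactly two indices [i] and [j] have the
    same minimizer.  A vertex [x] that completes [t] to a room takes over the
    minimum in one of these two orders, say [a]; it must then be above the
    minimum of [t] in all the other orders, and be the highest such vertex in
    the order [a].  So there is one candidate for each of the two indices, and
    both exist unless [t] is made of slack vertices only. *)
Lemma card_rooms_above_inner (t : {set V}) (t0 : V) : t0 \in t ->
  #|t|.+1 = #|I| -> (forall k, t != e @: (~: [set k])) ->
  ~~ odd #|[set S in rooms | t \subset S]|.
Proof.
move=> t0t card_t inner.
have [dt|ndt] := boolP (dominant r t); last first.
  rewrite (_ : [set _ in _ | _] = set0) ?cards0 //.
  apply/setP => S; rewrite inE in_set0; apply/negP => /rooms_aboveP -/(_ card_t).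
  by case=> x _ [_ /(dominantS (subsetUr _ _))]; rewrite (negPf ndt).
pose m i := [arg min_(x < t0 in t) r i x].
have m_in i : m i \in t by rewrite /m; case: arg_minnP.
have m_le i z : z \in t -> r i (m i) <= r i z.
  by rewrite /m; case: arg_minnP => // x _ h; exact: h.
have m_onto z : z \in t -> exists i, z = m i.
  move=> zt; have [i le_z] := dominantP _ _ dt z; exists i.
  by apply: (r_inj (i := i)); apply/eqP; rewrite eqn_leq le_z //= m_le.
have img_m : m @: [set: I] = t.
  apply/setP => z; apply/imsetP/idP => [[i _ ->] // | /m_onto[i ->]].
  by exists i.
have [i [j [ne_ij mij inj_i inj_j]]] : exists i j, [/\ i != j, m i = m j,
    {in ~: [set i] &, injective m} & {in ~: [set j] &, injective m}].
  by apply: two_collapsing_indices; rewrite img_m.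
pose M a : {set V} := [set y | [forall k, (k != a) ==> (r k (m k) < r k y)]].
have MP a y : reflect (forall k, k != a -> r k (m k) < r k y) (y \in M a).
  by rewrite inE; apply: (iffP forallP) => h k; have := h k => /implyP.
(* [e a] is a candidate: otherwise, in some order [k], no vertex of [t] is below
   [e a]; then [t] is made of slack vertices other than [e k]. *)
have M0 a : e a \in M a.
  apply/MP => k ka; rewrite ltnNge; apply/negP => le_k.
  have /negP := inner k; apply.
  rewrite eqEcard card_imset; last exact: e_inj.
  rewrite cardsC1 -card_t leqnn andbT; apply/subsetP => z zt.
  have le_z : r k (e a) <= r k z by apply: leq_trans le_k (m_le _ _ zt).
  have : z \in codom e.
    apply/negPn/negP => z_proper.
    have ne_az : e a != z by apply: contraNneq z_proper => <-; exact: codom_f.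
    have : r k (e a) = r k z.
      by apply/eqP; rewrite eqn_leq le_z e_top // eq_sym.
    by move/r_inj => eaz; rewrite eaz eqxx in ne_az.
  case/codomP => l zl; rewrite zl; apply/imsetP; exists l => //.
  rewrite !inE; apply: contraNneq ka => lk; move: le_z; rewrite zl lk => le_ak.
  by apply/eqP/e_inj/(r_inj (i := k))/eqP; rewrite eqn_leq le_ak e_min.
pose x a := [arg max_(y > e a in M a) r a y].
have x_in a : x a \in M a by rewrite /x; case: arg_maxnP.
have x_max a y : y \in M a -> r a y <= r a (x a).
  by rewrite /x; case: arg_maxnP => // z _ h; exact: h.
have x_ok a b : a != b -> m a = m b -> x a \notin t /\ dominant r (x a |: t).
  move=> ne_ab mab; split.
    apply/negP => /m_onto[k xk]; have /MP hx := x_in a.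
    have [ka|ka] := eqVneq k a; last by have := hx _ ka; rewrite xk ltnn.
    by have := hx b; rewrite eq_sym xk ka mab ltnn => /(_ ne_ab).
  apply/dominantP => y; have [yM|] := boolP (y \in M a).
    exists a => z /setU1P[->|zt]; first exact: x_max.
    have [k hk] := dominantP _ _ dt y.
    have [<-|ka] := eqVneq k a; first exact: hk.
    by have /MP/(_ _ ka) := yM; rewrite ltnNge hk.
  rewrite inE negb_forall => /existsP[k]; rewrite negb_imply -leqNgt.
  case/andP=> ka yk; exists k => z /setU1P[->|zt].
    by apply: (leq_trans yk); apply: ltnW; have /MP/(_ _ ka) := x_in a.
  exact: leq_trans yk (m_le _ _ zt).
(* Conversely, let [y] complete [t], and let [l] be the order that witnesses
   dominance at [y]: then the orders other than [l] still reach every vertex of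
   [t], so [l] is one of the two merged indices. *)
have ok_x y : y \notin t -> dominant r (y |: t) -> y = x i \/ y = x j.
  move=> yt /dominantP dy; have [l hl] := dy y.
  have lt_l z : z \in t -> r l y < r l z.
    move=> zt; rewrite ltn_neqAle hl ?inE ?zt ?orbT // andbT.
    by apply: contraNneq yt => /r_inj ->.
  have cover z : z \in t -> exists2 k, k != l & z = m k /\ r k z <= r k y.
    move=> zt; have [k hk] := dy z; exists k.
      apply: contraTneq (lt_l z zt) => <-.
      by rewrite -leqNgt hk // setU11.
    split; last by rewrite hk // setU11.
    apply: (r_inj (i := k)); apply/eqP; rewrite eqn_leq m_le // andbT.
    by rewrite hk // inE m_in orbT.
  have inj_l : {in ~: [set l] &, injective m}.
    apply/imset_injP; rewrite cardsC1 -card_t /= eqn_leq.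
    apply/andP; split; last first.
      apply/subset_leq_card/subsetP => z /cover[k kl [-> _]].
      by apply: imset_f; rewrite !inE.
    by apply/subset_leq_card/subsetP => _ /imsetP[k _ ->].
  have yMl : y \in M l.
    apply/MP => k kl; have [k' k'l [mk' le']] := cover _ (m_in k).
    have kk' : k = k' by apply: inj_l; rewrite ?inE.
    rewrite -kk' in le'; rewrite ltn_neqAle le' andbT.
    by apply: contraNneq yt => /r_inj <-.
  have y_max z : z \in M l -> r l z <= r l y.
    move=> /MP zM; have [k hk] := dy z.
    have [<-|kl] := eqVneq k l; first by rewrite hk // setU11.
    by have := zM _ kl; rewrite ltnNge hk // inE m_in orbT.
  have yx : y = x l.
    by apply: (r_inj (i := l)); apply/eqP; rewrite eqn_leq x_max // y_max.
  have [<-|li] := eqVneq l i; first by left.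
  have [<-|lj] := eqVneq l j; first by right.
  have ij : i = j by apply: inj_l; rewrite // !inE eq_sym.
  by rewrite ij eqxx in ne_ij.
have [xit dxi] := x_ok i j ne_ij mij.
have [xjt dxj] : x j \notin t /\ dominant r (x j |: t).
  by apply: (x_ok j i); rewrite // eq_sym.
have ne_x : x i != x j.
  apply/eqP => xij; have [k hk] := dominantP _ _ dt (x i).
  have : r k (m k) < r k (x i).
    have [->|ki] := eqVneq k i; last by have /MP := x_in i; exact.
    by rewrite xij; have /MP := x_in j; exact.
  by rewrite ltnNge hk.
have -> : [set S in rooms | t \subset S] = [set x i |: t; x j |: t].
  apply/setP => S; rewrite [LHS]inE in_set2.
  apply/(rooms_aboveP S card_t)/orP => [[y yt [-> dy]]|].
    by case: (ok_x _ yt dy) => ->; [left|right].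
  by case=> /eqP ->; [exists (x i)|exists (x j)].
rewrite cards2; suff -> : x i |: t != x j |: t by [].
apply/negP => /eqP/setP/(_ (x i)); rewrite setU11 inE (negPf xit) inE.
by rewrite (negPf ne_x).
Qed.

(** The outer door opposite to [e k] opens on a single room: the added vertex has
    to be the highest proper vertex in the order [k]. *)
Lemma card_rooms_above_outer (k : I) :
  #|[set S in rooms | (e @: (~: [set k])) \subset S]| = 1.
Proof.
set t := e @: _.
have card_t : #|t|.+1 = #|I|.
  rewrite card_imset; last exact: e_inj.
  by rewrite cardsC1 prednK //; apply/card_gt0P; exists k.
have tP y : reflect (exists2 l, l != k & y = e l) (y \in t).
  by apply: (iffP imsetP) => -[l]; rewrite ?inE => lk ->; exists l; rewrite ?inE.
pose x := [arg max_(y > v0 | y \notin codom e) r k y].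
have x_proper : x \notin codom e by rewrite /x; case: arg_maxnP.
have x_max y : y \notin codom e -> r k y <= r k x.
  by rewrite /x; case: arg_maxnP => // z _ h; exact: h.
have proper_lt l y : y \notin codom e -> r l y <= r l (e l) -> False.
  move=> /negP y_proper le_y; apply: y_proper.
  have -> : y = e l by apply: (r_inj (i := l)); apply/eqP; rewrite eqn_leq le_y e_min.
  exact: codom_f.
suff -> : [set S in rooms | t \subset S] = [set x |: t] by rewrite cards1.
apply/setP => S; rewrite [LHS]inE [RHS]inE.
apply/(rooms_aboveP S card_t)/eqP => [[y yt [-> /dominantP dy]]|->].
  have y_proper : y \notin codom e.
    apply/negP => /codomP[l yl].
    have lk : l = k by apply/eqP; apply: contraNT yt => lk; apply/tP; exists l.
    have [h hh] := dy v0; apply: (proper_lt h v0) => //; apply: hh.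
    rewrite inE yl lk inE; have [->|hk] := eqVneq h k; first by rewrite eqxx.
    by apply/orP; right; apply/tP; exists h.
  congr (_ |: _); apply: (r_inj (i := k)); apply/eqP; rewrite eqn_leq x_max //=.
  have [h hh] := dy x.
  have [<-|hk] := eqVneq h k; first by rewrite hh // setU11.
  exfalso; apply: (proper_lt h x) => //; apply: hh.
  by rewrite inE; apply/orP; right; apply/tP; exists h.
exists x; last split=> //.
  by apply/negP => /tP[l _ xl]; move: x_proper; rewrite xl codom_f.
apply/dominantP => y; have [/codomP[l ->]|y_proper] := boolP (y \in codom e).
  by exists l.
exists k => z /setU1P[->|/tP[l lk ->]]; first exact: x_max.
exact: e_top.
Qed.

(** A room without the full set of colours has either no door of colours
    [~: [set i0]], or exactly two of them, obtained by removing one or the other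
    of the two vertices that share a colour. *)
Lemma card_doors_below (i0 : I) (S : {set V}) :
  S \in rooms -> c @: S != [set: I] ->
  ~~ odd #|[set t : {set V} | (#|t|.+1 == #|I|) && (c @: t == ~: [set i0])
                              & t \subset S]|.
Proof.
rewrite inE => /andP[_ /eqP cardS] colS.
set D := [set t : {set V} | _ & _].
have [->|[t]] := set_0Vmem D; first by rewrite cards0.
rewrite inE => /andP[/andP[/eqP card_t /eqP col_t] tS].
have /cards1P[x Sx] : #|S :\: t| == 1.
  by rewrite cardsD (setIidPr tS) cardS -card_t subSnn.
have defS : S = x |: t by rewrite -(setID S t) (setIidPr tS) Sx setUC.
have xt : x \notin t.
  have : x \in S :\: t by rewrite Sx set11.
  by rewrite inE => /andP[].
have inj_t : {in t &, injective c}.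
  by apply/imset_injP; rewrite col_t cardsC1 -card_t.
have cx : c x != i0.
  apply: contraNneq colS => cx; rewrite defS imsetU1 cx col_t.
  by apply/eqP/setP => i; rewrite !inE; case: eqP.
have /imsetP[z zt cxz] : c x \in c @: t by rewrite col_t !inE.
have ne_xz : x != z by apply: contraNneq xt => ->.
have colS' : c @: S = ~: [set i0].
  by rewrite defS imsetU1 col_t; apply/setUidPr; rewrite sub1set !inE.
have xS : x \in S by rewrite defS setU11.
have zS : z \in S by rewrite (subsetP tS).
suff -> : D = [set S :\ x; S :\ z].
  rewrite cards2; suff -> : S :\ x != S :\ z by [].
  by apply/eqP => /setP/(_ x); rewrite !inE eqxx ne_xz xS.
have Sxt : S :\ x = t by rewrite defS setU1K.
apply/setP => s; rewrite in_set2 inE; apply/andP/orP => [[]|].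
  move=> /andP[/eqP card_s /eqP col_s] sS.
  have /cards1P[y Sy] : #|S :\: s| == 1.
    by rewrite cardsD (setIidPr sS) cardS -card_s subSnn.
  have defs : s = S :\ y.
    by rewrite -Sy setDDr setDv set0U (setIidPr sS).
  have inj_s : {in s &, injective c}.
    by apply/imset_injP; rewrite col_s cardsC1 -card_s.
  have [yx|yx] := eqVneq y x; first by left; rewrite defs yx.
  have [yz|yz] := eqVneq y z; first by right; rewrite defs yz.
  have : x = z by apply: inj_s; rewrite // defs !inE 1?eq_sym ?yx ?yz.
  by move/eqP; rewrite (negPf ne_xz).
case=> /eqP ->; rewrite subD1set.
  by rewrite Sxt card_t col_t !eqxx.
split=> //; apply/andP; split.
  by rewrite -cardS (cardsD1 z S) zS.
rewrite -colS'; apply/eqP/setP => i; apply/imsetP/imsetP => -[y].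
  by rewrite inE => /andP[_ yS] ->; exists y.
move=> yS ->; have [->|yz] := eqVneq y z; last by exists y => //; rewrite !inE yz.
by exists x; rewrite -?cxz // !inE ne_xz xS.
Qed.

Lemma even_sum (T : Type) (s : seq T) (P : pred T) (F : T -> nat) :
  (forall x, P x -> ~~ odd (F x)) -> ~~ odd (\sum_(x <- s | P x) F x).
Proof.
move=> evenF; apply: (big_ind (fun n => ~~ odd n)) => //.
by move=> m n /negPf om /negPf on; rewrite oddD om on.
Qed.

(** Count modulo 2 the pairs of a door with all colours but [i0] and a room above
    it.  Were there no room with all colours, every room would be in an even
    number of pairs; but so is every such door, except the one made of slack
    vertices, which is in exactly one. *)
Lemma scarf_colourful_dominant_set :
  exists2 S : {set V}, dominant r S & c @: S = [set: I].
Proof.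
pose i0 := c v0.
pose door (t : {set V}) := (#|t|.+1 == #|I|) && (c @: t == ~: [set i0]).
pose t0 := e @: (~: [set i0]).
have ce_id (A : {set I}) : c @: (e @: A) = A.
  by rewrite -imset_comp -[RHS]imset_id; apply: eq_imset => i /=.
have card_t0 : #|t0|.+1 = #|I|.
  rewrite card_imset; last exact: e_inj.
  by rewrite cardsC1 prednK //; apply/card_gt0P; exists i0.
have door_t0 : door t0 by rewrite /door ce_id card_t0 !eqxx.
have [/exists_inP[S] | /exists_inPn none] :=
    boolP [exists S in rooms, c @: S == [set: I]].
  by rewrite inE => /andP[dS _] /eqP colS; exists S.
pose b (t S : {set V}) : nat := t \subset S.
have card_sum (P Q : pred {set V}) :
    \sum_(S | P S) (Q S : nat) = #|[set S : {set V} | P S & Q S]|.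
  rewrite -sum1dep_card big_mkcondr /=.
  by apply: eq_bigr => S _; case: (Q S).
have : \sum_(t | door t) \sum_(S in rooms) b t S
     = \sum_(S in rooms) \sum_(t | door t) b t S by exact: exchange_big.
move/(congr1 odd); rewrite (bigD1 t0) //= oddD.
rewrite [in X in X (+) _](card_sum _ (fun S => t0 \subset S)).
rewrite card_rooms_above_outer.
rewrite [X in _ (+) X]negbTE; last first.
  apply: even_sum => t /andP[/andP[/eqP card_t /eqP col_t] tt0].
  rewrite (card_sum _ (fun S => t \subset S)).
  have inner k : t != e @: (~: [set k]).
    apply: contraNneq tt0 => tk.
    move: col_t; rewrite tk ce_id => /setP/(_ i0).
    by rewrite !inE eqxx /t0 => /negbFE/eqP ->.
  have [t_e|[z zt]] := set_0Vmem t; last exact: (card_rooms_above_inner zt).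
  move: (inner i0); rewrite eq_sym t_e -cards_eq0 -eqSS card_t0 -card_t t_e.
  by rewrite cards0.
rewrite [RHS]negbTE // even_sum // => S SR.
rewrite (card_sum _ (fun t => t \subset S)).
by apply: card_doors_below => //; exact: none.
Qed.

End Scarf.

(** * Colourings of the grid of a simplex *)

Section Grid.
Variables (I : finType) (k : nat).

Definition grid : predArgType :=
  {v : {ffun I -> 'I_k.+1} | \sum_i (v i : nat) == k}.
Definition coord (t : grid) (i : I) : nat := val t i.

Lemma sum_coord t : \sum_i coord t i = k.
Proof. exact/eqP/(valP t). Qed.

Lemma grid_of (f : I -> nat) : \sum_i f i = k -> exists t, coord t =1 f.
Proof.
move=> sum_f.
have lt_f i : f i < k.+1 by rewrite ltnS -sum_f (bigD1 i) //= leq_addr.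
pose v := [ffun i => Ordinal (lt_f i)].
have vP : \sum_i (v i : nat) == k.
  by apply/eqP; rewrite -[RHS]sum_f; apply: eq_bigr => i _; rewrite ffunE.
by exists (Sub v vP) => i; rewrite /coord SubK ffunE.
Qed.

(** Grid points are ranked by their [i]-th coordinate, ties being broken in a way
    that does not depend on [i]; the slack vertex [inr i] comes before all of
    them, and the other slack vertices after. *)
Definition grid_rank (i : I) (x : grid + I) : nat :=
  match x with
  | inl t => (coord t i * #|{: grid}| + enum_rank t).+1
  | inr j => if j == i then 0 else (k.+1 * #|{: grid}| + enum_rank j).+1
  end.

Lemma coord_le t i : coord t i <= k.
Proof. by rewrite -ltnS; exact: ltn_ord. Qed.

Lemma grid_rank_lt_top i t :
  coord t i * #|{: grid}| + enum_rank t < k.+1 * #|{: grid}|.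
Proof.
rewrite mulSn addnC -addSn leq_add //.
by rewrite leq_mul2r coord_le orbT.
Qed.

Lemma grid_rank_inj i : injective (grid_rank i).
Proof.
have lt_top := grid_rank_lt_top i.
move=> [t|j] [t'|j'] /=.
- move=> [] /(congr1 (modn^~ #|{: grid}|)).
  by rewrite !modnMDl !modn_small // => /val_inj/enum_rank_inj ->.
- by case: eqP => // _ [] eq_r; have := lt_top t; rewrite eq_r; lia.
- by case: eqP => // _ [] eq_r; have := lt_top t'; rewrite -eq_r; lia.
case: eqP => [->|_]; case: eqP => [->|_] // [] /addnI.
by move/val_inj/enum_rank_inj ->.
Qed.

Lemma grid_rank_le i t t' :
  grid_rank i (inl t) <= grid_rank i (inl t') -> coord t i <= coord t' i.
Proof.
rewrite /= ltnS => le_r; rewrite leqNgt; apply/negP => lt_c.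
have le_S : (coord t' i).+1 * #|{: grid}| <= coord t i * #|{: grid}|.
  by rewrite leq_mul2r lt_c orbT.
have := leq_trans (leq_ltn_trans le_r _) le_S.
rewrite mulSn addnC ltn_add2r => /(_ (ltn_ord _)).
by rewrite ltnNge leq_addr.
Qed.

End Grid.

(** A form of the lemma of Knaster, Kuratowski and Mazurkiewicz without boundary
    condition: however the points of the grid of mesh [1 / k] in a simplex are
    coloured by the vertices, some point [w] is close to a point of each colour
    that appears in the support of [w].  In a dominant set the coordinatewise
    minima over the coordinates of its face add up to almost [k], hence all its
    points are close to each other and to that face. *)
Lemma labelled_grid (I : finType) (i0 : I) (k : nat)
    (col : (I -> nat) -> I) :
  exists2 w : I -> nat, \sum_i w i = k &
    forall i, 0 < w i -> exists v : I -> nat,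
      [/\ \sum_i v i = k, col v = i &
          forall j, v j <= w j + #|I| /\ w j <= v j + #|I|].
Proof.
have [t0 _] : exists t : grid I k, coord t =1 fun i => (i == i0) * k.
  by apply: grid_of; rewrite (bigD1 i0) //= eqxx mul1n big1 ?addn0 // => i /negPf->.
pose c (x : grid I k + I) := match x with inl t => col (coord t) | inr j => j end.
have e_min i (x : grid I k + I) : grid_rank i (inr i : grid I k + I) <= grid_rank i x.
  by rewrite /= eqxx.
have e_top i j (x : grid I k + I) : x \notin codom inr -> j != i ->
    grid_rank i x <= grid_rank i (inr j : grid I k + I).
  case: x => [t|l] /= x_proper /negPf ji; last by rewrite codom_f in x_proper.
  rewrite ji ltnS; apply: ltnW; apply: leq_trans (grid_rank_lt_top i t) _.
  exact: leq_addr.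
have t0_proper : inl t0 \notin codom (@inr (grid I k) I).
  by apply/negP => /codomP[].
have [S /dominantP dS colS] :=
  scarf_colourful_dominant_set (@grid_rank_inj I k) e_min e_top t0_proper
    (c := c) (fun=> erefl).
(* The face [C] spanned by the coordinates whose slack vertex is not used. *)
pose C i := inr i \notin S.
have colour i : C i -> exists2 t, inl t \in S & col (coord t) = i.
  move=> Ci; have : i \in c @: S by rewrite colS.
  case/imsetP=> -[t|j] xS /= ij; first by exists t.
  by move: Ci; rewrite /C ij xS.
(* A slack vertex in [S] has the least rank in its own order, so dominance can
   only come from an order of [C]. *)
have dominated f : \sum_i f i = k ->
    exists2 i, C i & forall t, inl t \in S -> f i <= coord t i.
  case/grid_of => y yf; have [i hi] := dS (inl y).
  exists i; first by apply/negP => /hi; rewrite /= eqxx.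
  by move=> t /hi/grid_rank_le; rewrite yf.
have [i1 Ci1 _] := dominated _ (sum_coord t0).
have [t1 t1S _] := colour i1 Ci1.
pose a i := coord [arg min_(t < t1 | inl t \in S) coord t i] i.
have a_le t i : inl t \in S -> a i <= coord t i.
  by rewrite /a; case: arg_minnP => // s _; apply.
have a_attained i : exists2 t, inl t \in S & a i = coord t i.
  by rewrite /a; case: arg_minnP => // s sS _; exists s.
pose d := k - \sum_(i | C i) a i.
have sum_C t : inl t \in S ->
    \sum_(i | C i) a i + \sum_(i | C i) (coord t i - a i)
      + \sum_(i | ~~ C i) coord t i = k.
  move=> tS; rewrite -[RHS](sum_coord t) (bigID C predT) /= -big_split /=.
  by congr (_ + _); apply: eq_bigr => i _; rewrite subnKC // a_le.
have sum_a : \sum_(i | C i) a i <= k.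
  by rewrite -(sum_C _ t1S) -addnA leq_addr.
(* Putting the missing mass on the coordinate [i1] turns [g] into a grid point. *)
have pad_sum (g : I -> nat) (P : pred I) : P i1 ->
    \sum_(i | P i) (g i + (i == i1) * (k - \sum_(i | P i) g i)) =
    maxn k (\sum_(i | P i) g i).
  move=> Pi1; rewrite big_split /= [X in _ + X](bigD1 i1) //= eqxx mul1n.
  rewrite [X in _ + (_ + X)]big1 ?addn0; first by rewrite maxnE addnC; lia.
  by move=> i /andP[_ /negPf->].
(* Otherwise adding 1 to all the minima would leave the sum at most [k], and a
   grid point above all of them would contradict dominance. *)
have d_le : d <= #|I|.
  rewrite leqNgt; apply/negP => lt_d.
  have sum_aS : \sum_(i | C i) (a i).+1 <= k.
    have card_C : \sum_(i | C i) 1 <= #|I| by rewrite sum1dep_card max_card.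
    rewrite -(eq_bigr _ (fun i _ => addn1 (a i))) big_split /=.
    by move: lt_d; rewrite /d; lia.
  pose f i := if C i then (a i).+1 + (i == i1) * (k - \sum_(i | C i) (a i).+1) else 0.
  have [|i Ci hi] := dominated f.
    by rewrite -big_mkcond pad_sum //; apply/maxn_idPl.
  have [t tS at_] := a_attained i.
  by have := hi t tS; rewrite /f Ci -at_; lia.
pose w i := if C i then a i + (i == i1) * d else 0.
exists w; first by rewrite -big_mkcond pad_sum //; apply/maxn_idPl.
move=> i; rewrite {1}/w; case: ifP => // Ci _.
have [t tS ct] := colour i Ci.
exists (coord t); split=> //; first exact: sum_coord.
move=> j; have := sum_C t tS; have := a_le t j tS; rewrite /w.
case: ifP => Cj.
  rewrite [X in _ + X + _](bigD1 j) //=; move: d_le; rewrite /d.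
  move: (coord t j) (a j) #|I| (\sum_(i | C i) a i).
  move: (\sum_(i | _ && _) _) (\sum_(i | ~~ _) _) => ? ? ? ? ? ?.
  by case: (j == i1) => /=; lia.
rewrite [X in _ + X](bigD1 j) ?Cj //=; move: d_le; rewrite /d.
move: (coord t j) (a j) #|I| (\sum_(i | C i) a i).
by move: (\sum_(i | C i) _) (\sum_(i | ~~ _ && _) _); lia.
Qed.

(** * Profiles and stability of improving deviations *)

Import Order.TTheory GRing.Theory Num.Theory numFieldNormedType.Exports.
Local Open Scope classical_set_scope.
Local Open Scope ring_scope.

(* The characterization of compactness by open covers is about pointed spaces. *)
HB.instance Definition _ (R : realType) (N : finType) (dim : N -> nat) :=
  isPointed.Build (profile R dim) 0.

Section Box.
Variables (R : realType) (N : finType) (dim : N -> nat).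
Implicit Types (x y : profile R dim) (A : set (profile R dim)).

(** The open ball of the supremum norm. *)
Definition box x (e : R) : set (profile R dim) :=
  [set y | forall nu, `|y nu - x nu| < e].

Lemma open_box x e : open (box x e).
Proof.
rewrite openE => y yx.
suff : \forall z \near y, forall nu, `|z nu - x nu| < e by [].
pose near_x nu := [set z : profile R dim | `|z nu - x nu| < e].
have := @filter_forall _ N near_x (nbhs y) (nbhs_filter y); apply=> nu.
have : z nu @[z --> y] --> y nu.
  exact: (@proj_continuous _ (fun nu => 'rV[R]_(dim nu)) nu y).
move/(_ [set v | `|v - x nu| < e]); apply.
apply/nbhs_ballP; exists (e - `|y nu - x nu|) => /=; first by rewrite subr_gt0.
move=> v; rewrite -ball_normE /= ltrBrDr distrC; apply: le_lt_trans.
by rewrite -[v - x nu](subrKA (y nu)) ler_normD.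
Qed.

(** As there are finitely many players, boxes form a base of neighbourhoods. *)
Lemma nbhs_box x A : nbhs x A -> exists2 e, 0 < e & box x e `<=` A.
Proof.
pose F := filter_from [set e : R | 0 < e] (box x).
have FF : Filter F.
  apply: filter_from_filter; first by exists 1 => /=.
  move=> d e d0 e0; exists (Num.min d e); first by rewrite /= lt_min; apply/andP.
  by move=> y yx; split=> nu; have := yx nu; rewrite lt_min => /andP[].
suff cvF : F --> (x : prod_topology (fun nu => 'rV[R]_(dim nu))).
  by move/cvF => [e e0 xA]; exists e.
apply/cvg_sup => nu B /=.
rewrite (@nbhsE (initial_topology (fun y : profile R dim => y nu))).
case=> C [[D oD <-] /= xD] CB.
have /nbhs_ballP[e /= e0 eD] : nbhs (x nu) D by exact: open_nbhs_nbhs.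
suff : exists2 e, 0 < e & box x e `<=` B by [].
exists e => // y yx; apply: CB; apply: eD; rewrite /= -ball_normE /=.
by rewrite distrC; exact: yx.
Qed.

Lemma cover_compact_profile (X : set (profile R dim)) :
  compact X -> cover_compact X.
Proof. by rewrite compact_cover. Qed.

End Box.

(** For a pseudo-continuous function, a strict inequality is stable under moving
    both points.  If some value lies strictly between [f x] and [f y], it
    separates them.  If none does, then near [x] and [y] we have [f x' < f y] and
    [f x < f y'], and [f y' <= f x'] would make [f y'] such a value. *)
Lemma pseudo_continuous_lt (R : realType) (T : topologicalType) (f : T -> R)
    (x y : T) : pseudo_continuous f -> f x < f y ->
  exists A B, [/\ nbhs x A, nbhs y B &
    forall x' y', A x' -> B y' -> f x' < f y'].
Proof.
move=> [ucf lcf] fxy.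
have lower z w : f w < f z -> \forall z' \near z, f w < f z'.
  move=> wz; have := lcf z w; rewrite ltrN2 => /(_ wz).
  by apply: filterS => z'; rewrite ltrN2.
have [[z xz zy]|between] := pselect (exists2 z, f x < f z & f z < f y).
  exists [set x' | f x' < f z], [set y' | f z < f y']; split.
  - exact: ucf.
  - exact: lower.
  - by move=> x' y' /=; exact: lt_trans.
exists [set x' | f x' < f y], [set y' | f x < f y']; split.
- exact: ucf.
- exact: lower.
move=> x' y' /= x'y xy'; rewrite ltNge; apply/negP => y'x'.
by apply: between; exists y' => //; exact: le_lt_trans x'y.
Qed.

Lemma deviateE (R : realType) (N : finType) (dim : N -> nat)
    (x : profile R dim) nu (v : 'rV[R]_(dim nu)) : deviate x v nu = v.
Proof. exact: dfwithin. Qed.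

Lemma deviate_neq (R : realType) (N : finType) (dim : N -> nat)
    (x : profile R dim) nu (v : 'rV[R]_(dim nu)) mu :
  mu != nu -> deviate x v mu = x mu.
Proof. by move=> ne; apply: dfwithout; rewrite eq_sym. Qed.

Lemma deviate_id (R : realType) (N : finType) (dim : N -> nat)
    (x : profile R dim) nu : deviate x (x nu) = x.
Proof.
apply: functional_extensionality_dep => mu.
by have [->|ne] := eqVneq mu nu; [exact: deviateE | exact: deviate_neq].
Qed.

(** An improving deviation [v] stays improving when [x] and [v] are perturbed,
    with a uniform margin [d].  The perturbed deviations may leave the feasible
    set; they will only be compared by quasi-convexity on the whole space. *)
Lemma improving_deviation_stable (R : realType) (N : finType) (dim : N -> nat)
    (f : profile R dim -> R) (x : profile R dim) nu (v : 'rV[R]_(dim nu)) :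
  pseudo_continuous f -> f (deviate x v) < f x ->
  exists2 d, 0 < d & forall x' (v' : 'rV[R]_(dim nu)),
    box x d x' -> `|v' - v| <= d -> f (deviate x' v') < f x'.
Proof.
move=> cf /(pseudo_continuous_lt cf)[A [B [/nbhs_box[a a0 aA] /nbhs_box[b b0 bB] lt_f]]].
exists (Num.min a b / 2); first by rewrite divr_gt0 ?lt_min ?a0.
have lt_d e : (e <= Num.min a b / 2) -> e < a /\ e < b.
  have m0 : 0 < Num.min a b by rewrite lt_min a0.
  have ma : Num.min a b <= a by rewrite ge_min lexx.
  have mb : Num.min a b <= b by rewrite ge_min lexx orbT.
  by split; lra.
move=> x' v' xx' vv'; apply: lt_f.
  apply: aA => mu; have [->|ne] := eqVneq mu nu.
    by rewrite !deviateE; have [] := lt_d _ vv'.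
  by rewrite !deviate_neq //; have [] := lt_d _ (ltW (xx' mu)).
by apply: bB => mu; have [] := lt_d _ (ltW (xx' mu)).
Qed.

(** * Averages and quasi-convexity *)

Definition segment_closed (R : realType) (E : lmodType R) (K : set E) :=
  forall (x y : E) (t : R), 0 <= t -> t <= 1 -> K x -> K y ->
    K (t *: x + (1 - t) *: y).

(** Only the points of positive weight are asked to be in [K], so that a subfamily
    can be selected by giving weight zero to the other points. *)
Lemma convex_combination (R : realType) (E : lmodType R) (K : set E)
    (I : finType) (l : I -> R) (z : I -> E) :
  segment_closed K -> (forall i, 0 <= l i) -> (forall i, 0 < l i -> K (z i)) ->
  0 < \sum_i l i -> K ((\sum_i l i)^-1 *: \sum_i l i *: z i).
Proof.
move=> Kconv l_ge0 Kz.
suff main s : (\sum_(i <- s) l i = 0 /\ \sum_(i <- s) l i *: z i = 0) \/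
    (0 < \sum_(i <- s) l i /\
     K ((\sum_(i <- s) l i)^-1 *: \sum_(i <- s) l i *: z i)).
  by have [[-> _]|[_]] := main (index_enum I); rewrite ?ltxx.
elim: s => [|i s IH]; first by left; rewrite !big_nil.
rewrite !big_cons; have [li0|li_neq0] := eqVneq (l i) 0.
  by rewrite li0 scale0r !add0r.
have li_gt0 : 0 < l i by rewrite lt_def li_neq0 l_ge0.
right; case: IH => [[-> ->]|[S_gt0 KS]].
  by rewrite !addr0 scalerA mulVf // scale1r; split=> //; exact: Kz.
have T_gt0 := addr_gt0 li_gt0 S_gt0; split=> //.
set S := \sum_(j <- s) l j in S_gt0 KS T_gt0 *.
have := Kconv _ _ (l i / (l i + S)) _ _ (Kz i li_gt0) KS.
rewrite scalerDr !scalerA [l i / _]mulrC.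
have -> : (1 - (l i + S)^-1 * l i) * S^-1 = (l i + S)^-1.
  by field; rewrite !gt_eqF.
apply; first by rewrite mulr_ge0 ?invr_ge0 // ltW.
by rewrite mulrC ler_pdivrMr // mul1r lerDl ltW.
Qed.

Lemma convex_set_segment_closed (R : realType) (E : lmodType R) (K : set E) :
  convex_set K -> segment_closed K.
Proof.
move=> Kconv x y t t0 t1 Kx Ky.
exact: set_mem (Kconv x y (Itv01 t0 t1) (mem_set Kx) (mem_set Ky)).
Qed.

Lemma quasi_convex_sublevel (R : realType) (E : lmodType R) (f : E -> R) a :
  quasi_convex f -> segment_closed [set x | f x < a].
Proof.
move=> qf x y t t0 t1 /= fx fy; apply: le_lt_trans (qf x y t t0 t1) _.
by rewrite gt_max fx.
Qed.

Lemma profile_sumE (R : realType) (N : finType) (dim : N -> nat) (I : finType)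
    (P : pred I) (y : I -> profile R dim) mu :
  (\sum_(i | P i) y i) mu = \sum_(i | P i) y i mu.
Proof. exact: (big_morph (fun x : profile R dim => x mu)). Qed.

Lemma sum_argmax (R : realType) (N : finType) (W : N -> R) : (0 < #|N|)%N ->
  exists mu, (\sum_nu W nu) / #|N|%:R <= W mu.
Proof.
move=> N_gt0; apply: contrapT => /forallNP W_lt.
have N_gt0' : 0 < #|N|%:R :> R by rewrite ltr0n.
have /card_gt0P[nu0 _] := N_gt0.
suff : \sum_nu W nu < \sum_nu W nu by rewrite ltxx.
apply: (@lt_le_trans _ _ (\sum_(nu : N) (\sum_nu W nu) / #|N|%:R)).
  apply: ltr_sum; first by apply/hasP; exists nu0; rewrite ?mem_index_enum.
  by move=> nu _; rewrite ltNge; apply/negP; exact: W_lt.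
by rewrite [leLHS]sumr_const -[leLHS]mulr_natr divfK // gt_eqF.
Qed.

(** No profile [x] is an average of deviations [y i] that improve with margin
    [d i] on [x], where [y i] is a deviation of the player [nu i] and nearly
    agrees with [x] for the other players.  In the component of a player [mu],
    the deviations of [mu] balance the small errors [e] coming from those of the
    others.  For the player with the largest total margin [W mu], the error is at
    most [W mu]; it can therefore be distributed among the deviations of [mu]
    within their margins, and the corrected deviations [z i] average to [x mu].
    By quasi-convexity [x mu] would improve on itself.  This argument replaces
    the separation of [x mu] from its strict sublevel set by a normal vector. *)
Lemma no_self_average (R : realType) (N : finType) (dim : N -> nat)
    (theta : N -> profile R dim -> R) (I : finType) (l d : I -> R)
    (nu : I -> N) (y : I -> profile R dim) (x : profile R dim) :
  (forall mu, quasi_convex_own mu (theta mu)) ->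
  (forall i, 0 <= l i) -> \sum_i l i = 1 -> x = \sum_i l i *: y i ->
  (forall i, 0 < l i -> 0 < d i) ->
  (forall i mu, 0 < l i -> mu != nu i -> `|y i mu - x mu| <= d i / #|N|%:R) ->
  (forall i (v : 'rV[R]_(dim (nu i))), 0 < l i -> `|v - y i (nu i)| <= d i ->
     theta (nu i) (deviate x v) < theta (nu i) x) ->
  False.
Proof.
move=> qc l_ge0 sum_l x_avg d_gt0 others improve.
have [i0 li0] : exists i, 0 < l i.
  apply: contrapT => /forallNP l_le0; suff : \sum_i l i = 0.
    by move/eqP; rewrite sum_l oner_eq0.
  by apply: big1 => i _; apply/eqP; rewrite eq_le l_ge0 leNgt andbT; apply/negP.
have ld_ge0 i : 0 <= l i * d i.
  have [->|li] := eqVneq (l i) 0; first by rewrite mul0r.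
  by rewrite mulr_ge0 // ltW // d_gt0 // lt_def li l_ge0.
pose W mu := \sum_(i | nu i == mu) l i * d i.
have sumW : \sum_mu W mu = \sum_i l i * d i.
  by rewrite [RHS](partition_big nu xpredT).
have N_gt0 : (0 < #|N|)%N by apply/card_gt0P; exists (nu i0).
have [mu Wmu] := sum_argmax W N_gt0.
have W_gt0 : 0 < W mu.
  apply: lt_le_trans Wmu; rewrite divr_gt0 ?ltr0n // sumW (bigD1 i0) //=.
  by rewrite ltr_pwDl ?mulr_gt0 ?d_gt0 // sumr_ge0.
pose S := \sum_(i | nu i == mu) l i.
have S_gt0 : 0 < S.
  rewrite lt_def sumr_ge0 ?andbT //; apply: contraTneq W_gt0 => S0.
  rewrite -leNgt /W big1 // => i nui.
  by rewrite (psumr_eq0P _ S0) ?mul0r // => j _.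
pose e := \sum_(i | nu i != mu) l i *: (x mu - y i mu).
have e_bal : \sum_(i | nu i == mu) l i *: (y i mu - x mu) = e.
  have : \sum_i l i *: (y i mu - x mu) = 0.
    under eq_bigr do rewrite scalerBr.
    rewrite sumrB -scaler_suml sum_l scale1r; apply/eqP; rewrite subr_eq0.
    apply/eqP; rewrite [RHS](congr1 (fun x : profile R dim => x mu) x_avg).
    by rewrite profile_sumE.
  rewrite (bigID (fun i => nu i == mu)) /= => /eqP; rewrite addr_eq0 => /eqP ->.
  by rewrite -sumrN; apply: eq_bigr => i _; rewrite -scalerN opprB.
have e_le : `|e| <= W mu.
  apply: le_trans Wmu; rewrite sumW mulr_suml.
  apply: le_trans (ler_norm_sum _ _ _) _.
  rewrite [leRHS](bigID (fun i => nu i != mu)) /= ler_wpDr ?sumr_ge0 //.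
    by move=> i _; rewrite mulr_ge0 ?invr_ge0.
  apply: ler_sum => i nui; rewrite normrZ ger0_norm // -mulrA distrC.
  have [->|li] := eqVneq (l i) 0; first by rewrite !mul0r.
  by rewrite ler_wpM2l // others ?lt_def ?li ?l_ge0 // eq_sym.
pose z i := y i mu - (d i / W mu) *: e.
pose K : set 'rV[R]_(dim mu) := [set v | theta mu (deviate x v) < theta mu x].
pose l' i := if nu i == mu then l i else 0.
have Kz i : 0 < l' i -> K (z i).
  rewrite /l'; case: (eqVneq (nu i) mu); last by rewrite ltxx.
  move=> nui li; rewrite /K /=.
  have zy : `|z i - y i mu| <= d i.
    rewrite /z addrAC subrr add0r normrN normrZ ger0_norm; last first.
      by rewrite divr_ge0 ?ltW ?d_gt0.
    rewrite mulrAC ler_pdivrMr // ler_wpM2l // ltW // d_gt0 //.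
  (* [improve] speaks of [nu i], which is only propositionally equal to [mu]. *)
  move: (z i) zy; rewrite -nui => v; exact: improve.
have sum_l' : \sum_i l' i = S by rewrite /l' -big_mkcond.
have sum_l'z : \sum_i l' i *: z i = S *: x mu.
  rewrite (eq_bigr (fun i => if nu i == mu then l i *: z i else 0)); last first.
    by move=> i _; rewrite /l'; case: ifP; rewrite ?scale0r.
  rewrite -big_mkcond /=.
  rewrite (eq_bigr (fun i => l i *: (y i mu - x mu) + l i *: x mu
                             - (l i * d i / W mu) *: e)); last first.
    move=> i _; rewrite /z -[in RHS]scalerDr subrK -[in RHS]mulrA.
    by rewrite -[in RHS]scalerA -[RHS]scalerBr.
  rewrite sumrB big_split /= e_bal -2!scaler_suml -mulr_suml divff ?gt_eqF //.
  by rewrite scale1r addrAC subrr add0r.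
have : K ((\sum_i l' i)^-1 *: \sum_i l' i *: z i).
  apply: convex_combination Kz _; last by rewrite sum_l'.
    exact: quasi_convex_sublevel (qc mu x).
  by move=> i; rewrite /l'; case: ifP.
rewrite sum_l' sum_l'z scalerA mulVf ?gt_eqF // scale1r.
by rewrite /K /= deviate_id ltxx.
Qed.

(** * Existence of an equilibrium *)

(** If [X] is covered by boxes indexed by [I] and to each [i] is attached a point
    [y i] of [X], then some average of the [y i] lies in (twice) the box [i] for
    each [i] of positive weight.  Colour a fine grid of averages by a box that
    contains the average; the mesh is chosen so that grid points at distance
    [#|I|] give averages at distance less than all the radii. *)
Lemma common_point_of_box_cover (R : realType) (N : finType) (dim : N -> nat)
    (X : set (profile R dim)) (I : finType) (i0 : I)
    (x y : I -> profile R dim) (r : I -> R) :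
  convex_set X -> (forall i, X (y i)) -> (forall i, 0 < r i) ->
  X `<=` \bigcup_i box (x i) (r i) ->
  exists l : I -> R, [/\ forall i, 0 <= l i, \sum_i l i = 1 &
    forall i, 0 < l i -> box (x i) (r i + r i) (\sum_j l j *: y j)].
Proof.
move=> /convex_set_segment_closed Xconv Xy r_gt0 X_cover.
pose n := #|I|.
have [M M_gt0 y_le] : exists2 M, 0 < M & forall i mu, `|y i mu| <= M.
  exists (1 + \sum_i \sum_mu `|y i mu|).
    by rewrite ltr_pwDl // sumr_ge0 // => i _; rewrite sumr_ge0.
  move=> i mu; rewrite (bigD1 i) //= (bigD1 mu) //= addrCA -!addrA lerDl.
  rewrite !addr_ge0 // sumr_ge0 // => j _; exact: sumr_ge0.
have [eta eta_gt0 eta_le] : exists2 eta, 0 < eta & forall i, eta <= r i.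
  have rV_gt0 i : 0 < (r i)^-1 by rewrite invr_gt0.
  have S_gt0 : 0 < \sum_i (r i)^-1.
    by rewrite (bigD1 i0) //= ltr_pwDl // sumr_ge0 // => i _; exact: ltW.
  (* any positive lower bound will do; this one avoids taking a minimum *)
  exists (\sum_i (r i)^-1)^-1; first by rewrite invr_gt0.
  move=> i; rewrite -[r i]invrK lef_pV2 ?posrE // (bigD1 i) //= lerDl.
  by rewrite sumr_ge0 // => j _; exact: ltW.
have [k k_gt0 mesh] :
    exists2 k : nat, 0 < k%:R :> R & n%:R * (n%:R * M) / k%:R < eta.
  exists (Num.bound (n%:R * (n%:R * M) / eta)).+1; first by rewrite ltr0n.
  rewrite ltr_pdivrMr ?ltr0n // -ltr_pdivrMl // mulrC.
  apply: lt_le_trans (archi_boundP _) _; last by rewrite ler_nat.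
  by apply: divr_ge0; [apply: mulr_ge0; [|apply: mulr_ge0]|]; rewrite // ltW.
pose weight (v : I -> nat) i : R := (v i)%:R / k%:R.
have weight_ge0 v i : 0 <= weight v i by rewrite divr_ge0.
have sum_weight v : (\sum_i v i = k)%N -> \sum_i weight v i = 1.
  by move=> sum_v; rewrite -mulr_suml -natr_sum sum_v divff // gt_eqF.
pose p v := \sum_i weight v i *: y i.
have Xp v : (\sum_i v i = k)%N -> X (p v).
  move/sum_weight => sum_v.
  have := @convex_combination _ _ X _ (weight v) y Xconv (weight_ge0 v).
  by rewrite sum_v invr1 scale1r; apply.
have /choice[col colP] v : exists i, (\sum_i v i = k)%N -> box (x i) (r i) (p v).
  have [/Xp/X_cover[i _ pv]|no] := pselect (\sum_i v i = k)%N; first by exists i.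
  by exists i0.
have [w sum_w near_w] := labelled_grid i0 k col.
exists (weight w); split=> // [|i]; first exact: sum_weight.
rewrite pmulr_lgt0 ?invr_gt0 // ltr0n => /near_w[v [sum_v col_v vw]] mu.
have pv : `|p v mu - x i mu| < r i by rewrite -col_v; exact: colP.
rewrite -[_ - _](subrKA (p v mu)).
apply: le_lt_trans (ler_normD _ _) _; rewrite ltrD //.
apply: le_lt_trans _ (lt_le_trans mesh (eta_le i)).
rewrite /p !profile_sumE -sumrB; apply: le_trans (ler_norm_sum _ _ _) _.
have -> : n%:R * (n%:R * M) / k%:R = \sum_(j : I) n%:R * M / k%:R.
  by rewrite [RHS]sumr_const -[RHS]mulr_natl [RHS]mulrA.
apply: ler_sum => j _.
have -> : (weight w j *: y j) mu - (weight v j *: y j) mu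
        = (weight w j - weight v j) *: y j mu by rewrite scalerBl.
rewrite normrZ -mulrBl normrM mulrAC [Num.norm _^-1]gtr0_norm ?invr_gt0 //.
rewrite ler_wpM2r ?invr_ge0 ?ler0n // ler_pM ?y_le //.
have [vw1 vw2] := vw j.
by rewrite ler_norml lerNl opprB !lerBlDr -!natrD !ler_nat ![(n + _)%N]addnC vw1.
Qed.

Theorem theorem4p6 (R : realType) (N : finType) (dim : N -> nat)
    (theta : N -> profile R dim -> R) (X : set (profile R dim))
    (hN : (0 < #|N|)%N)
    (hXconv : convex_set X) (hXcomp : compact X) (hX0 : X !=set0)
    (hcont : forall nu : N, pseudo_continuous (theta nu))
    (hqc : forall nu : N, quasi_convex_own nu (theta nu)) :
  RGNEP theta X !=set0.
Proof.
apply/set0P/negP => /eqP no_eq.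
pose deviation : Type := ({nu : N & 'rV[R]_(dim nu)} * R)%type.
pose improves (x : profile R dim) (q : deviation) :=
  let nu := projT1 q.1 in let v := projT2 q.1 in
  [/\ 0 < q.2, X (deviate x v) &
    forall x' (v' : 'rV[R]_(dim nu)), box x q.2 x' -> `|v' - v| <= q.2 ->
      theta nu (deviate x' v') < theta nu x'].
have improvable x : X x -> exists q, improves x q.
  move=> Xx; apply: contrapT => /forallNP no_dev.
  suff : RGNEP theta X x by rewrite no_eq.
  split=> // nu v Xv; rewrite leNgt; apply/negP => lt_v.
  have [d d0 hd] := improving_deviation_stable (hcont nu) lt_v.
  by apply: (no_dev (existT _ nu v, d)); split.
have [x0 Xx0] := hX0.
have [q0 _] := improvable x0 Xx0.
have /choice[q qP] x : exists q, X x -> improves x q.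
  by have [/improvable[q hq]|] := pselect (X x); [exists q | exists q0].
have N_ge1 : 1 <= #|N|%:R :> R by rewrite ler1n.
have N_gt0 : 0 < #|N|%:R :> R by rewrite ltr0n.
(* With half of the margin divided by [#|N|], a point in the doubled box is as
   close to [x] as the averaging argument requires. *)
pose rho x := (q x).2 / #|N|%:R / 2.
have rho_gt0 x : X x -> 0 < rho x.
  by case/qP=> q_gt0 _ _; rewrite !divr_gt0.
have [D DX X_cover] : finite_subset_cover X (fun x => box x (rho x)) X.
  apply: cover_compact_profile => // [x _|x Xx]; first exact: open_box.
  by exists x => // nu; rewrite subrr normr0; exact: rho_gt0.
have XD (i : D) : X (val i) by apply: set_mem; apply: DX; exact: valP.
have [x1 Dx1 _] := X_cover _ Xx0.
pose x (i : D) := val i.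
pose nu i := projT1 (q (x i)).1.
pose y i := deviate (x i) (projT2 (q (x i)).1).
have Xy i : X (y i) by have [] := qP _ (XD i).
have cover_box : X `<=` \bigcup_i box (x i) (rho (x i)).
  by move=> z /X_cover[i /= Di zi]; exists [` Di]%fset.
have [l [l_ge0 sum_l near_avg]] :=
  common_point_of_box_cover ([` Dx1]%fset : D) hXconv Xy
    (fun i => rho_gt0 _ (XD i)) cover_box.
have two_rho i : rho (x i) + rho (x i) = (q (x i)).2 / #|N|%:R.
  by rewrite /rho -splitr.
apply: (no_self_average (nu := nu) (y := y) (d := fun i => (q (x i)).2)
          hqc l_ge0 sum_l erefl).
- by move=> i _; have [] := qP _ (XD i).
- move=> i mu li ne; rewrite /y deviate_neq // distrC -two_rho ltW //.
  exact: near_avg.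
move=> i v li; rewrite {1}/y deviateE; have [q_gt0 _ stable] := qP _ (XD i).
apply: stable => mu; apply: lt_le_trans (near_avg i li mu) _.
by rewrite two_rho ler_pdivrMr // ler_peMr // ltW.
Qed.
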